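(* Fix a finite set $\mathcal{D}\subset\mathbb{Z}_{\ge 0}$ of degrees and consider the class of parallel Bayesian congestion games with polynomial latency functions whose degrees come from $\mathcal{D}$ (as defined in the context; traffic rate $r=1$). For any such game with edge set $E$, any prior distribution $\mu_0$ over the latency coefficients, and any signalling policy $\pi$, the decrease in the expected total latency of a Bayes-Nash flow from signalling, when the signal-aware incentive mechanism $T^\star$ is used, satisfies $$0\;\le\;\mathrm{Ben}(\pi;\mu_0,T^\star)\;\le\;\Xi\,\lVert\mathbb{E}[\alpha]-\alpha^-\rVert_2,$$ where $$\Xi:=|\mathcal{D}|+\frac{\rho^+-\rho_0^-}{4\rho_1^-}\Big(|E|+\sum_{d\in\mathcal{D}\setminus\{0\}}(d+1)^d\Big),$$ $\rho_0^-=\min_{e\in E}\alpha^-_{e,0}$, $\rho_1^-=\min_{e\in E}\alpha^-_{e,1}$, $\rho^+=\max_{e\in E}\sum_{d\in\mathcal{D}}(d+1)\alpha^+_{e,d}$, and $\mathbb{E}[\alpha]=\int_{x\in A}x\,\mu_0(x)\,dx$ is the mean of $\alpha$ under $\mu_0$.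
   Context: Parallel congestion game: a finite nonempty set $E$ of parallel edges from a source to a terminal, used by a continuum of agents $x\in[0,r]$ of total mass $r=1$. A flow is $f=(f_e)_{e\in E}$ with $f_e\ge0$ and $\sum_{e}f_e=r$. Edge $e$ has latency function $\ell_e(f_e)=\sum_{d\in\mathcal{D}}\alpha_{e,d}(f_e)^d$ with $\alpha_{e,d}\ge0$, where $\mathcal{D}$ is a finite set of nonnegative integers. The coefficient vector is $\alpha\in\mathbb{R}_{\ge0}^{|E|\cdot|\mathcal{D}|}$. The total latency is $\mathcal{L}(f;\alpha)=\sum_{e\in E}f_e\ell_e(f_e)$. Bayesian congestion game: $\alpha$ is a random vector with distribution (prior) $\mu_0$ and bounded support $A$. Set $\alpha^-_{e,d}=\inf\,\mathrm{supp}(\alpha_{e,d})$ and $\alpha^+_{e,d}=\sup\,\mathrm{supp}(\alpha_{e,d})$, with $\alpha^-,\alpha^+$ the corresponding vectors (these need not lie in $A$). Standing assumption: $0,1\in\mathcal{D}$, and $\alpha^-_{e,0}>0$, $\alpha^-_{e,1}>0$ for every $e\in E$. For a distribution $\mu$ on coefficients, $\mathcal{L}(f;\mu)=\mathbb{E}_{\alpha\sim\mu}[\sum_e f_e\ell_e(f_e)]$. Signalling policy: a finite partition $\pi=\{\pi_1,\dots,\pi_m\}$ of $A$ into nonempty (measurable) disjoint sets. When $\alpha\in\pi_i$, all agents are publicly and truthfully told so and update to the posterior $\mu_i$, the conditional law of $\alpha$ given $\alpha\in\pi_i$; $p_i=\mathbb{P}_{\mu_0}[\alpha\in\pi_i]$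 (taken positive so that $\mu_i$ is defined). The notation $\pi=\emptyset$ means that no information is shared: there is a single belief $\mu_0$ (equivalently a single uninformative signal with posterior $\mu_0$). Signal-aware incentive mechanism $T$: assigns to each edge $e$ and signal $\pi_i$ a constant toll $\tau_e(\pi_i)\in\mathbb{R}$ (depending on $\pi_i,\pi,\mu_0$). The mechanism $T^\star$ assigns $$\tau^\star_e(\pi_i)=\sum_{d\in\mathcal{D}}d\;\mathbb{E}_{\alpha\sim\mu_i}[\alpha_{e,d}]\,(x_e)^d,\qquad x\in\arg\min_f\mathcal{L}\big(f;\mathbb{E}_{\alpha\sim\mu_i}[\alpha]\big),$$ the minimum being over flows; for $\pi=\emptyset$ the same formula is used with $\mu_0$ in place of $\mu_i$. Bayes-Nash flow under $T$: agent $x$ has a strategy $\sigma_x=(\sigma_x(\pi_i))_{i=1}^m\in E^m$, and $\mathbf{f}=(f(\pi_i))_{i=1}^m$, where $f_e(\pi_i)$ is the mass of agents with $\sigma_x(\pi_i)=e$. Agent $x$'s cost is $J_x(\sigma_x;\mathbf{f},\mu_0,\pi,T)=\sum_{i=1}^m p_i\,\mathbb{E}_{\alpha\sim\mu_i}\big[\ell_{\sigma_x(\pi_i)}\big(f_{\sigma_x(\pi_i)}(\pi_i)\big)+\tau_{\sigma_x(\pi_i)}(\pi_i)\big]$. $(\mathbf{f}^{\rm BN},\sigma^{\rm BN})$ is a Bayes-Nash equilibrium, and $\mathbf{f}^{\rm BN}$ a Bayes-Nash flow, if no agent can lower its cost by switching to any $\sigma'\in E^m$. The expected total latency (tolls not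 counted) is $\mathcal{L}(\mathbf{f}^{\rm BN};\mu_0,\pi,T)=\sum_{i=1}^m p_i\,\mathcal{L}(f^{\rm BN}(\pi_i);\mu_i)$, where $\mathbf{f}^{\rm BN}$ is a Bayes-Nash flow under $\pi$ and $T$. Benefit: $\mathrm{Ben}(\pi;\mu_0,T)=\mathcal{L}(\mathbf{f}^{\rm BN};\mu_0,\emptyset,T)-\mathcal{L}(\mathbf{f}^{\rm BN};\mu_0,\pi,T)$, where each term uses a Bayes-Nash flow for the respective information structure. *)

(* Defs.v *)
From HB Require Import structures.
From mathcomp Require Import all_boot all_order all_algebra finmap.
From mathcomp Require Import all_classical all_reals all_analysis.

Set Implicit Arguments.
Unset Strict Implicit.
Unset Printing Implicit Defensive.

Import Order.TTheory GRing.Theory Num.Theory.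
Import numFieldNormedType.Exports.

Local Open Scope classical_set_scope.
Local Open Scope ring_scope.

(* Topological support: for a law on R or on the coefficient space this is the
   smallest closed set of full measure. *)
Definition msupport (R : realType) (T : topologicalType)
    (mu : set T -> \bar R) : set T :=
  [set x | forall U : set T, open U -> U x -> (0 < mu U)%E].

(* The edges form the finite type E, the degrees the finite set D; an element
   of the coefficient space is a real vector indexed by E * D. *)
Definition coefs (R : realType) (E : finType) (D : {fset nat}) :=
  {ptws (E * D)%type -> R}.

(* Laws of the coefficient vector are probabilities on the Borel sets. *)
Definition belief (R : realType) (E : finType) (D : {fset nat}) :=
  probability (g_sigma_algebraType (@open (coefs R E D))) R.

Definition coef (R : realType) (E : finType) (D : {fset nat})
  (e : E) (d : D) (a : coefs R E D) : R := a (e, d).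

Section Game.
Variables (R : realType) (E : finType) (D : {fset nat}).
Local Notation coefs := (coefs R E D).
Local Notation belief := (belief R E D).

Definition is_flow (f : E -> R) : Prop :=
  (forall e, 0 <= f e) /\ \sum_e f e = 1.

Definition latency (a : coefs) (e : E) (y : R) : R :=
  \sum_(d : D) coef e d a * y ^+ val d.

Definition total_latency (f : E -> R) (a : coefs) : R :=
  \sum_e f e * latency a e (f e).

(* Under a law with bounded support the quantities below have finite
   expectations, so fine loses nothing. *)
Definition exp_under (mu : belief) (X : coefs -> R) : R := fine 'E_mu[X].

Definition mean_coefs (mu : belief) : coefs :=
  fun ed => exp_under mu (coef ed.1 ed.2).

Definition total_latency_under (f : E -> R) (mu : belief) : R :=
  exp_under mu (total_latency f).

Definition marginal (mu : belief) (e : E) (d : D) : set R -> \bar R :=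
  pushforward mu (coef e d : _ -> measurableTypeR R).

Definition alpha_minus (mu : belief) (e : E) (d : D) : R :=
  inf (msupport (marginal mu e d)).

Definition alpha_plus (mu : belief) (e : E) (d : D) : R :=
  sup (msupport (marginal mu e d)).

Definition prior_support (mu0 : belief) : set coefs := @msupport R coefs mu0.

(* Boundedness in R^(E * D), expressed in the sup norm. *)
Definition bounded_coefs (A : set coefs) : Prop :=
  exists M : R, forall a, A a -> forall e d, `|coef e d a| <= M.

Record policy (mu0 : belief) := Policy {
  nsignals : nat;
  cell : 'I_nsignals -> set coefs;
  cell_measurable : forall i,
    measurable (cell i : set (g_sigma_algebraType (@open coefs)));
  cell_nonempty : forall i, cell i !=set0;
  cell_disjoint : trivIset setT cell;
  cell_cover : \bigcup_(i in setT) cell i = prior_support mu0;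
  cell_pos : forall i, (0 < mu0 (cell i))%E }.

Section Information.
Variable mu0 : belief.

(* An information structure is Some pi for a signalling policy pi, and None
   when no information is shared; the latter has one signal of probability 1,
   after which the belief is mu0. *)
Definition info := option (policy mu0).

Definition signal (s : info) : finType :=
  if s is Some pi then 'I_(nsignals pi) else unit.

Definition signal_prob (s : info) : signal s -> R :=
  match s return signal s -> R with
  | Some pi => fun i => fine (mu0 (cell i))
  | None => fun=> 1
  end.

(* The conditional law of the coefficients given a cell of the policy; the last
   argument of mnormalize is a default value for a cell of probability 0, which
   cell_pos excludes. *)
Definition posterior (s : info) : signal s -> belief :=
  match s return signal s -> belief with
  | Some pi => fun i => mnormalize (mrestr mu0 (cell_measurable i)) mu0
  | None => fun=> mu0
  end.

Definition mechanism := forall s : info, signal s -> E -> R.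

Definition is_opt_flow (a : coefs) (x : E -> R) : Prop :=
  is_flow x /\ forall f, is_flow f -> total_latency x a <= total_latency f a.

Definition Tstar_toll (a : coefs) (x : E -> R) (e : E) : R :=
  \sum_(d : D) (val d)%:R * coef e d a * x e ^+ val d.

Definition is_Tstar (T : mechanism) : Prop :=
  forall (s : info) (i : signal s),
    exists x : E -> R, is_opt_flow (mean_coefs (posterior i)) x /\
      forall e, T s i e = Tstar_toll (mean_coefs (posterior i)) x e.

(* The agents are the points of [0, 1], with Lebesgue measure as mass. *)
Definition agents_on (s : info) (sigma : R -> signal s -> E)
    (i : signal s) (e : E) : set R :=
  [set x | `[0, 1]%classic x /\ sigma x i = e].

Definition agent_cost (s : info) (T : mechanism) (f : signal s -> E -> R)
    (st : signal s -> E) : R :=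
  \sum_(i : signal s) signal_prob i *
    exp_under (posterior i)
      (fun a => latency a (st i) (f i (st i)) + T s i (st i)).

Definition is_BN_equilibrium (s : info) (T : mechanism)
    (f : signal s -> E -> R) (sigma : R -> signal s -> E) : Prop :=
  [/\ forall i e, measurable (agents_on sigma i e),
      forall i e, f i e = fine (lebesgue_measure (agents_on sigma i e)) &
      forall x, `[0, 1]%classic x -> forall st : signal s -> E,
        agent_cost T f (sigma x) <= agent_cost T f st].

Definition is_BN_flow (s : info) (T : mechanism) (f : signal s -> E -> R) :
    Prop :=
  exists sigma : R -> signal s -> E, is_BN_equilibrium T f sigma.

Definition expected_latency (s : info) (f : signal s -> E -> R) : R :=
  \sum_(i : signal s) signal_prob i * total_latency_under (f i) (posterior i).

(* b is the benefit of pi computed with some choice of Bayes-Nash flows, one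
   without information and one under pi. *)
Definition is_benefit (pi : policy mu0) (T : mechanism) (b : R) : Prop :=
  exists (f0 : signal None -> E -> R) (f : signal (Some pi) -> E -> R),
    [/\ is_BN_flow T f0, is_BN_flow T f &
        b = expected_latency f0 - expected_latency f].

End Information.

Definition mean_gap (mu0 : belief) : R :=
  Num.sqrt (\sum_e \sum_(d : D)
    (mean_coefs mu0 (e, d) - alpha_minus mu0 e d) ^+ 2).

(* E is finite and nonempty, so the infimum and the supremum below are the
   minimum and the maximum over the edges. *)
Definition rho_minus (mu0 : belief) (d : D) : R :=
  inf (range (fun e => alpha_minus mu0 e d)).

Definition rho_plus (mu0 : belief) : R :=
  sup (range (fun e => \sum_(d : D) (val d).+1%:R * alpha_plus mu0 e d)).

Definition Xi (mu0 : belief) (h0 : 0%N \in D) (h1 : 1%N \in D) : R :=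
  #|` D|%:R +
  (rho_plus mu0 - rho_minus mu0 [` h0]%fset) /
    (4%:R * rho_minus mu0 [` h1]%fset) *
  (#|E|%:R + \sum_(d : D | val d != 0%N) (val d).+1%:R ^+ val d).

End Game.

(* Main.v *)
(** Under the tolls of T* a Bayes-Nash flow after a signal satisfies the same
    variational inequality as the optimal flow of the game with the posterior
    mean coefficients; adding the two inequalities and using that latencies are
    strictly increasing (the degree-1 coefficients are positive), the two flows
    coincide. So the benefit is L*(m) - sum_i p_i L*(m_i), where L* is the
    optimal total latency, m the prior mean and m_i the posterior means, with
    sum_i p_i m_i = m. It is nonnegative because L* is concave, as a minimum of
    functions linear in the coefficients. Testing L*(m) with the posterior
    flows f_i, it is at most sum_i p_i (L(f_i; m) - L(f_i; alpha^-)), which is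
    at most |D| times the norm of m - alpha^- because f_i is a flow. This is
    stronger than the claim since |D| <= Xi. *)
Require Import Defs.
From HB Require Import structures.
From mathcomp Require Import all_boot all_order all_algebra finmap.
From mathcomp Require Import all_classical all_reals all_analysis.
From mathcomp Require Import measurable_realfun ring lra.

Set Implicit Arguments.
Unset Strict Implicit.
Unset Printing Implicit Defensive.

Import Order.TTheory GRing.Theory Num.Theory.
Import numFieldNormedType.Exports.

Local Open Scope classical_set_scope.
Local Open Scope ring_scope.

(** * Support of a law on a finite power of the reals *)

Lemma msupport_closed (R : realType) (T : topologicalType) (mu : set T -> \bar R) :
  closed (msupport mu).
Proof.
rewrite -[X in closed X]setCK; apply: open_closedC; rewrite openE => a.
move=> /existsNP[U /not_implyP[oU /not_implyP[Ua mU]]].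
by rewrite /interior nbhsE; exists U => // b Ub /(_ U oU Ub).
Qed.

Section second_countability.
Variables (R : realType) (I : finType).
Implicit Types (a b : {ptws I -> R}) (U : set {ptws I -> R}).

Definition box (q : I -> R) (r : R) : set {ptws I -> R} :=
  [set b | forall i, `|b i - q i| < r].

Lemma ptws_coord_continuous (i : I) : continuous (fun a : {ptws I -> R} => a i).
Proof. exact: (@proj_continuous I (fun=> R) i). Qed.

(** The pointwise topology is a supremum of the topologies induced by the coordinates, so
    convergence of the filter of boxes around [a] can be checked one coordinate at a time. *)
Lemma nbhs_box a U : nbhs a U -> exists n : nat, box a n.+1%:R^-1 `<=` U.
Proof.
pose F := filter_from [set: nat] (fun n => box a n.+1%:R^-1).
have FF : Filter F.
  apply: filter_from_filter; first by exists 0%N.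
  move=> m n _ _; exists (maxn m n) => // b mn; split=> i.
    apply: lt_le_trans (mn i) _; rewrite lef_pV2 ?posrE// ler_nat ltnS.
    exact: leq_maxl.
  apply: lt_le_trans (mn i) _; rewrite lef_pV2 ?posrE// ler_nat ltnS.
  exact: leq_maxr.
have Fa : F --> a.
  apply/cvg_sup => i V [W [[Z oZ <-] Za WV]].
  have /nbhs_ballP[e /= e0 eZ] : nbhs (a i) Z by exact: open_nbhs_nbhs.
  have [n en] := ltr_add_invr e0.
  exists n => // b /(_ i) /= ab; apply: WV; apply: eZ.
  rewrite /ball/= distrC; apply: lt_le_trans ab _.
  by apply: ltW; move: en; rewrite add0r; exact.
by move/Fa => [n _ nU]; exists n.
Qed.

(** Rational centres and radii of the form 1/(n+1) give a countable base, because [I] is finite and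
    [{ffun I -> rat}] is thus countable. *)
Lemma box_rat a U : open U -> U a ->
  exists k : nat * {ffun I -> rat},
    let B := box (fun i => ratr (k.2 i)) k.1.+1%:R^-1 in B a /\ B `<=` U.
Proof.
move=> oU Ua; have [n nU] : exists n : nat, box a n.+1%:R^-1 `<=` U.
  by apply: nbhs_box; exact: open_nbhs_nbhs.
(* This is half of 1/(n+1): a box of radius [r] whose centre is within [r] of [a] stays inside the
   box of radius 1/(n+1) around [a]. *)
pose r : R := (n.*2.+1).+1%:R^-1.
have rE : r + r = n.+1%:R^-1.
  rewrite /r -doubleS -muln2 natrM; field.
  by rewrite addrC natr1 pnatr_eq0.
have r0 : 0 < r by rewrite invr_gt0.
have /choice[q qP] : forall i, exists q : rat, `|a i - ratr q| < r.
  move=> i; have [|q] := @rat_in_itvoo R (a i - r) (a i + r); first by lra.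
  rewrite in_itv/= => /andP[aq qa]; exists q.
  by rewrite ltr_norml; apply/andP; split; lra.
exists (n.*2.+1, [ffun i => q i]); split=> [i|b bq].
  by rewrite ffunE; exact: qP.
apply: nU => i; move: (bq i) (qP i); rewrite ffunE /= => bqi aqi.
rewrite -rE (_ : b i - a i = (b i - ratr (q i)) - (a i - ratr (q i))); last by ring.
by apply: le_lt_trans (ler_normB _ _) _; apply: ltrD.
Qed.

Variable mu : probability (g_sigma_algebraType (@open {ptws I -> R})) R.

Lemma open_borel U :
  open U -> measurable (U : set (g_sigma_algebraType (@open {ptws I -> R}))).
Proof. by move=> oU; exact: sub_sigma_algebra. Qed.

Lemma support_measurable :
  measurable (@msupport R {ptws I -> R} mu
    : set (g_sigma_algebraType (@open {ptws I -> R}))).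
Proof.
rewrite -[X in measurable X]setCK; apply: measurableC; apply: open_borel.
exact/closed_openC/msupport_closed.
Qed.

(* By [box_rat] the complement of the support is covered by countably many
   boxes that are null. *)
Lemma supportC_null : mu (~` @msupport R {ptws I -> R} mu) = 0%E.
Proof.
set S := msupport _.
pose B (k : nat * {ffun I -> rat}) : set {ptws I -> R} :=
  box (fun i => ratr (k.2 i)) k.1.+1%:R^-1.
(* [F n] is the box with code [n] if that box is negligible, and empty otherwise. Negligibility
   passes to subsets, so a box inside a null open set qualifies without a proof that boxes are
   measurable. *)
pose F (n : nat) : set (g_sigma_algebraType (@open {ptws I -> R})) :=
  [set a | exists k : nat * {ffun I -> rat},
    [/\ choice.unpickle n = Some k, mu.-negligible (B k) & B k a]].
have Fnull n : mu.-negligible (F n).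
  have [[k [nk Bk]]|nB] := pselect (exists k : nat * {ffun I -> rat},
      choice.unpickle n = Some k /\ mu.-negligible (B k)).
    apply: negligibleS Bk => a [k' [nk' _]].
    by move: nk'; rewrite nk => -[->].
  apply: negligibleS (negligible_set0 mu) => a [k [nk Bk _]].
  by apply: nB; exists k.
apply: measure_negligible.
  by apply: measurableC; exact: support_measurable.
apply: negligibleS (negligible_bigcup Fnull) => a.
move=> /existsNP[U /not_implyP[oU /not_implyP[Ua mU]]].
have [k [ka kU]] := box_rat oU Ua.
exists (choice.pickle k) => //; exists k; split=> //; first by rewrite choice.pickleK.
exists U; split=> //; first exact: open_borel.
by apply/eqP; move/negP: mU; rewrite lt0e measure_ge0 andbT negbK.
Qed.

Lemma coord_measurable (i : I) :
  measurable_fun [set: g_sigma_algebraType (@open {ptws I -> R})]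
    (fun a : {ptws I -> R} => a i : measurableTypeR R).
Proof.
apply: (measurability _ (RGenOpens.measurableE R)) => _ [_ [x [y ->]] <-].
rewrite setTI; apply: open_borel; apply: open_comp; last exact: interval_open.
by move=> a _; exact: ptws_coord_continuous.
Qed.

End second_countability.

(** * Coefficients and their means *)

Section coefficients.
Variables (R : realType) (E : finType) (D : {fset nat}).
Implicit Types (mu nu : belief R E D) (e : E) (d : D).

Lemma coef_measurable e d : measurable_fun
  [set: g_sigma_algebraType (@open (coefs R E D))] (coef e d : _ -> R).
Proof. exact: (@coord_measurable R (E * D)%type (e, d)). Qed.

Lemma prior_support_measurable mu : measurable
  (prior_support mu : set (g_sigma_algebraType (@open (coefs R E D)))).
Proof. exact: support_measurable. Qed.

Lemma prior_supportC_null mu : mu (~` prior_support mu) = 0%E.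
Proof. exact: (@supportC_null R (E * D)%type mu). Qed.

Lemma prior_support_nonempty mu : prior_support mu !=set0.
Proof.
apply/set0P/eqP => S0; have := prior_supportC_null mu.
by rewrite S0 setC0 probability_setT => /eqP; rewrite onee_eq0.
Qed.

Lemma coef_marginal mu e d a :
  prior_support mu a -> msupport (marginal mu e d) (coef e d a).
Proof.
move=> Sa U oU Ua; apply: Sa => //.
by apply: open_comp => [b _|//]; exact: (@ptws_coord_continuous R (E * D)%type (e, d) b).
Qed.

(** An open neighbourhood of a point of the marginal support has positive mass, hence meets the
    image of the joint support, whose complement is null. The open half-lines below [l] and above
    [u] miss that image. *)
Lemma marginal_itv mu e d (l u : R) :
  (forall a, prior_support mu a -> l <= coef e d a <= u) ->
  forall y, msupport (marginal mu e d) y -> l <= y <= u.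
Proof.
move=> Slu y my.
have nS U : open U -> U y -> exists2 a, prior_support mu a & U (coef e d a).
  move=> oU Uy; apply: contrapT => nSU; have := my U oU Uy.
  apply/negP; rewrite -leNgt -(prior_supportC_null mu).
  rewrite /marginal /pushforward; apply: (le_measure mu); rewrite ?inE.
  - rewrite -[X in measurable X]setTI.
    by apply: (coef_measurable e d) => //; exact: open_measurable.
  - by apply: measurableC; exact: prior_support_measurable.
  - by move=> a Ua Sa; apply: nSU; exists a.
apply/andP; split; rewrite leNgt; apply/negP => ylu.
- by have [a /Slu/andP[la _]] := nS _ (@open_lt R l) ylu; rewrite /= ltNge la.
- by have [a /Slu/andP[_ au]] := nS _ (@open_gt R u) ylu; rewrite /= ltNge au.
Qed.

Section bounded_support.
Variables (mu : belief R E D) (M : R).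
Hypothesis S_itv : forall a, prior_support mu a ->
  forall e d, 0 <= coef e d a <= M.

(** Nonemptiness and a bound are what give [inf] and [sup] their meaning on the marginal support,
    rather than a default value. *)
Let has_inf_marginal e d : has_inf (msupport (marginal mu e d)).
Proof.
split.
  have [a Sa] := prior_support_nonempty mu.
  by exists (coef e d a); exact: coef_marginal.
by exists 0 => y /(marginal_itv (fun a Sa => S_itv Sa e d))/andP[].
Qed.

Let has_sup_marginal e d : has_sup (msupport (marginal mu e d)).
Proof.
split; first by case: (has_inf_marginal e d).
by exists M => y /(marginal_itv (fun a Sa => S_itv Sa e d))/andP[].
Qed.

Lemma alpha_minus_le_coef e d a : prior_support mu a ->
  alpha_minus mu e d <= coef e d a.
Proof.
move=> Sa; apply: ge_inf; first by case: (has_inf_marginal e d).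
exact: coef_marginal.
Qed.

Lemma coef_le_alpha_plus e d a : prior_support mu a ->
  coef e d a <= alpha_plus mu e d.
Proof.
move=> Sa; apply: ub_le_sup; first by case: (has_sup_marginal e d).
exact: coef_marginal.
Qed.

Lemma alpha_minus_ge0 e d : 0 <= alpha_minus mu e d.
Proof.
apply: lb_le_inf; first by case: (has_inf_marginal e d).
by move=> y /(marginal_itv (fun a Sa => S_itv Sa e d))/andP[].
Qed.

Lemma alpha_minus_le_plus e d : alpha_minus mu e d <= alpha_plus mu e d.
Proof.
have [a Sa] := prior_support_nonempty mu.
exact: le_trans (alpha_minus_le_coef e d Sa) (coef_le_alpha_plus e d Sa).
Qed.

Lemma alpha_plus_le e d : alpha_plus mu e d <= M.
Proof.
apply: ge_sup; first by case: (has_sup_marginal e d).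
by move=> y /(marginal_itv (fun a Sa => S_itv Sa e d))/andP[].
Qed.

Variable nu : belief R E D.
Hypothesis nuS : nu (~` prior_support mu) = 0%E.

(** Taking any law [nu] that is null off the support of [mu] covers the prior and all its posteriors
    at once. *)
Lemma coef_integrable e d : nu.-integrable setT (EFin \o coef e d).
Proof.
have mS := prior_support_measurable mu.
apply/(negligible_integrable (measurableC mS)) => //.
  by apply/measurable_EFinP; exact: coef_measurable.
rewrite setDE setTI setCK; apply: measurable_bounded_integrable => //.
- by rewrite (le_lt_trans (probability_le1 _ _))// ltry.
- by apply: (measurable_funS _ (@subsetT _ _)) => //; exact: coef_measurable.
- exists M; split; first exact: num_real.
  move=> x Mx a /S_itv/(_ e d)/andP[c0 cM].
  by rewrite /= ger0_norm//; exact: le_trans cM (ltW Mx).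
Qed.

Lemma exp_underE X : exp_under nu X = \int[nu]_a X a.
Proof. by rewrite /exp_under unlock. Qed.

Lemma mean_coefsE ed :
  (mean_coefs nu ed)%:E = (\int[nu]_a (coef ed.1 ed.2 a)%:E)%E.
Proof.
rewrite /mean_coefs exp_underE /Rintegral fineK//.
by apply: integrable_fin_num => //; exact: coef_integrable.
Qed.

(** For a fixed flow, an edge latency plus a toll and the total latency are both affine in the
    coefficients; [g] selects the coefficients that occur. *)
Lemma exp_under_linear (J : finType) (w : J -> R) (g : J -> E * D) (c : R) :
  exp_under nu (fun a => \sum_j w j * coef (g j).1 (g j).2 a + c) =
  \sum_j w j * mean_coefs nu (g j) + c.
Proof.
have iw j : nu.-integrable setT (fun a => (w j * coef (g j).1 (g j).2 a)%:E).
  have := integrableZl measurableT (w j) (coef_integrable (g j).1 (g j).2).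
  by apply: eq_integrable => // a _; rewrite /= EFinM.
have isum : nu.-integrable setT
    (EFin \o (fun a => \sum_j w j * coef (g j).1 (g j).2 a)).
  have := @integrable_sum _ _ _ nu _ measurableT _ (index_enum J) predT _ (fun j _ => iw j).
  by apply: eq_integrable => // a _; rewrite /= sumEFin.
rewrite exp_underE RintegralD//; last exact: finite_measure_integrable_cst.
rewrite Rintegral_cst//; congr (_ + _); last first.
  by rewrite -[RHS]mulr1; congr (_ * _); exact: (congr1 fine (probability_setT nu)).
rewrite /Rintegral.
under eq_integral do rewrite -sumEFin.
rewrite integral_sum// -sum_fine; last first.
  by move=> j _; exact: integrable_fin_num.
apply: eq_bigr => j _.
by rewrite -/(Rintegral _ _ _) RintegralZl//; [rewrite -exp_underE|exact: coef_integrable].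
Qed.

Lemma alpha_minus_le_mean e d : alpha_minus mu e d <= mean_coefs nu (e, d).
Proof.
have mS := prior_support_measurable mu.
have nuS1 : nu (prior_support mu) = 1%E.
  have := probability_setC nu (measurableC mS).
  by rewrite setCK nuS sube0.
rewrite /mean_coefs exp_underE /Rintegral /=.
rewrite (negligible_integral (measurableC mS))//; last exact: coef_integrable.
(* The constant becomes its own integral over the support, which has mass 1 under [nu]. *)
rewrite setDE setTI setCK -[leLHS]mulr1 -[1]/(fine 1%E) -nuS1 -Rintegral_cst//.
apply: le_Rintegral => //.
- by apply: finite_measure_integrable_cst.
- by apply: (integrableS measurableT) => //; exact: coef_integrable.
- by move=> a Sa; exact: alpha_minus_le_coef.
Qed.

End bounded_support.
End coefficients.

(** * Posterior laws and the law of total expectation *)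

Lemma mnormalize_finite d (T : measurableType d) (R : realType)
    (mu : measure T R) (P : probability T R) (r : R) A :
  0 < r -> mu setT = r%:E -> mnormalize mu P A = (mu A * r^-1%:E)%E.
Proof. by move=> r0 muT; rewrite /mnormalize muT eqe gt_eqF. Qed.

Section posteriors.
Variables (R : realType) (E : finType) (D : {fset nat}).
Variables (mu : belief R E D) (pi : policy mu).
Implicit Types i : signal (Some pi).

Let p i := @signal_prob _ _ _ mu (Some pi) i.
Let nu i := @posterior _ _ _ mu (Some pi) i.

Lemma cell_prob i : mu (cell i) = (p i)%:E.
Proof. by rewrite fineK// fin_num_measure//; exact: cell_measurable. Qed.

Lemma signal_prob_gt0 i : 0 < p i.
Proof. by rewrite -lte_fin -cell_prob; exact: cell_pos. Qed.

Lemma cell_sub_support i : cell i `<=` prior_support mu.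
Proof. by rewrite -(cell_cover pi) => a ia; exists i. Qed.

Lemma posteriorE i A : nu i A = (mu (A `&` cell i) * (p i)^-1%:E)%E.
Proof.
have muT : mrestr mu (cell_measurable i) setT = (p i)%:E.
  by rewrite /mrestr setTI cell_prob.
exact: mnormalize_finite (signal_prob_gt0 i) muT.
Qed.

Lemma posterior_supportC i : nu i (~` prior_support mu) = 0%E.
Proof.
rewrite posteriorE (_ : _ `&` _ = set0) ?measure0 ?mul0e//.
by apply/seteqP; split=> // a [nSa] /cell_sub_support.
Qed.

Lemma posterior_cellC i : nu i (~` cell i) = 0%E.
Proof. by rewrite posteriorE setICl measure0 mul0e. Qed.

Lemma support_bigsetU :
  \big[setU/set0]_(i < nsignals pi) cell i = prior_support mu.
Proof.
rewrite -(cell_cover pi) -bigcup_seq; apply: eq_bigcupl.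
by split=> i //= _; rewrite mem_index_enum.
Qed.

Lemma sum_signal_prob : \sum_i p i = 1.
Proof.
have mS := prior_support_measurable mu.
apply: EFin_inj; rewrite -sumEFin.
have -> : 1%:E = mu (prior_support mu).
  by have := probability_setC mu (measurableC mS); rewrite setCK prior_supportC_null sube0.
rewrite -support_bigsetU (measure_bigsetU_ord mu).
- by apply: eq_bigr => i _; apply: esym; exact: cell_prob.
- exact: cell_measurable.
- exact: cell_disjoint.
Qed.

Variable M : R.
Hypothesis S_itv : forall a, prior_support mu a ->
  forall e d, 0 <= coef e d a <= M.

(** The posterior lives on its cell, and on measurable subsets of the cell it is the prior scaled by
    the inverse of [p i]. *)
Lemma mean_posterior i ed : ((p i * mean_coefs (nu i) ed)%:E =
  \int[mu]_(a in cell i) (coef ed.1 ed.2 a)%:E)%E.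
Proof.
have mc := cell_measurable i; have p0 := signal_prob_gt0 i.
have ic := coef_integrable S_itv (posterior_supportC i) ed.1 ed.2.
rewrite EFinM (mean_coefsE S_itv (posterior_supportC i)).
rewrite (negligible_integral (measurableC mc))//; last exact: posterior_cellC.
rewrite setDE setTI setCK.
have k0 : 0 <= (p i)^-1 by rewrite invr_ge0 ltW.
rewrite (@eq_measure_integral _ _ _ _ (mscale (NngNum k0) mu)); last first.
  move=> A mA Ac; rewrite [LHS]posteriorE /mscale/= muleC.
  by rewrite (setIidl Ac).
rewrite ge0_integral_mscale//=.
- by rewrite muleA -EFinM divff ?mul1e ?gt_eqF.
- apply/measurable_EFinP; apply: (measurable_funS _ (@subsetT _ _)) => //.
  exact: coef_measurable.
- by move=> a /cell_sub_support/S_itv/(_ ed.1 ed.2)/andP[]; rewrite lee_fin.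
Qed.

(** Law of total expectation: the cells partition the support, so the integrals over them add up to
    the integral over a set of full measure. *)
Lemma sum_mean_posterior ed :
  \sum_i p i * mean_coefs (nu i) ed = mean_coefs mu ed.
Proof.
have mS := prior_support_measurable mu.
have ic := coef_integrable S_itv (prior_supportC_null mu) ed.1 ed.2.
apply: EFin_inj; rewrite -sumEFin.
under eq_bigr do rewrite mean_posterior.
rewrite (mean_coefsE S_itv (prior_supportC_null mu)).
rewrite (negligible_integral (measurableC mS))//; last exact: prior_supportC_null.
rewrite setDE setTI setCK -support_bigsetU integral_bigsetU_EFin//=.
- exact: cell_measurable.
- exact: index_enum_uniq.
- apply: (sub_trivIset (@subsetT _ _)); exact: cell_disjoint.
- rewrite support_bigsetU.
  apply/measurable_EFinP; apply: (measurable_funS _ (@subsetT _ _)) => //.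
  exact: coef_measurable.
Qed.

End posteriors.

(** * Optimal flows and tolled equilibria *)

(** A second-order Taylor bound with a crude constant, standing in for differentiation of the
    latencies. The induction step multiplies the bound by [y] and absorbs the error using that all
    quantities lie in [0, 1]. *)
Lemma exprS_sub_le (R : realFieldType) (x y : R) n : 0 <= x <= 1 -> 0 <= y <= 1 ->
  y ^+ n.+1 - x ^+ n.+1 <=
    n.+1%:R * x ^+ n * (y - x) + n.+1%:R ^+ 2 * (y - x) ^+ 2.
Proof.
move=> /andP[x0 x1] /andP[y0 y1]; elim: n => [|n IHn].
  by rewrite !expr1 expr0 !mulr1 mul1r expr1n mul1r lerDl sqr_ge0.
have xn0 : 0 <= x ^+ n by exact: exprn_ge0.
have xn1 : x ^+ n <= 1 by exact: exprn_ile1.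
have n0 : 0 <= n.+1%:R :> R by [].
have := ler_wpM2l y0 IHn.
rewrite !(exprS _ n.+1) (exprS x n) (exprS y n) -[n.+2%:R]natr1.
move: (n.+1%:R) n0 (x ^+ n) (y ^+ n) xn0 xn1 => k k0 u v u0 u1 IH.
have h0 : 0 <= (y - x) ^+ 2 by exact: sqr_ge0.
have h1 : k * u * (y - x) ^+ 2 <= k * (y - x) ^+ 2.
  by rewrite ler_wpM2r// ler_piMr.
have h2 : y * (k ^+ 2 * (y - x) ^+ 2) <= k ^+ 2 * (y - x) ^+ 2.
  by rewrite ler_piMl// mulr_ge0// sqr_ge0.
have h3 : 0 <= k * (y - x) ^+ 2 by exact: mulr_ge0.
lra.
Qed.

Section optimal_flows.
Variables (R : realType) (E : finType) (D : {fset nat}).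
Variable a : coefs R E D.
Hypothesis a_ge0 : forall e d, 0 <= coef e d a.
Implicit Types (f g x : E -> R).

Lemma flow_itv f e : is_flow f -> 0 <= f e <= 1.
Proof.
move=> [f0 <-]; rewrite f0 /= (bigD1 e)//= lerDl.
by apply: sumr_ge0 => e' _.
Qed.

Lemma flow_convex f g t : 0 <= t <= 1 -> is_flow f -> is_flow g ->
  is_flow (fun e => f e + t * (g e - f e)).
Proof.
move=> /andP[t0 t1] [f0 f1] [g0 g1]; split=> [e|].
  have -> : f e + t * (g e - f e) = (1 - t) * f e + t * g e by ring.
  by rewrite addr_ge0// mulr_ge0// subr_ge0.
by rewrite big_split/= -mulr_sumr sumrB f1 g1 subrr mulr0 addr0.
Qed.

Lemma total_latencyE f (b : coefs R E D) : total_latency f b =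
  \sum_(ed : E * D) f ed.1 ^+ (val ed.2).+1 * coef ed.1 ed.2 b.
Proof.
rewrite -(pair_bigA _ (fun e (d : D) => f e ^+ (val d).+1 * coef e d b))/=.
apply: eq_bigr => e _; rewrite /latency mulr_sumr.
by apply: eq_bigr => d _; rewrite exprS mulrCA mulrC.
Qed.

(** The partial derivative of the total latency in the flow on [e], as the next lemma makes
    visible. *)
Definition marginal_cost x e : R := latency a e (x e) + Tstar_toll a x e.

Lemma marginal_costE x e : marginal_cost x e =
  \sum_(d : D) (val d).+1%:R * coef e d a * x e ^+ val d.
Proof.
rewrite /marginal_cost /latency /Tstar_toll -big_split /=.
by apply: eq_bigr => d _; rewrite -natr1; ring.
Qed.

(** First-order optimality: moving from [x] towards [g] by a fraction t changes the total latency by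
    at most t(V + tC), so V + tC cannot be negative for any t in (0, 1]. *)
Lemma opt_flow_variational x g : is_opt_flow a x -> is_flow g ->
  0 <= \sum_e marginal_cost x e * (g e - x e).
Proof.
move=> [fx xmin] fg; set V := \sum_e _.
pose C := \sum_(ed : E * D)
  coef ed.1 ed.2 a * (val ed.2).+1%:R ^+ 2 * (g ed.1 - x ed.1) ^+ 2.
have C0 : 0 <= C.
  by apply: sumr_ge0 => ed _; rewrite mulr_ge0 ?sqr_ge0// mulr_ge0 ?sqr_ge0.
have VC t : 0 < t <= 1 -> 0 <= V + t * C.
  move=> /andP[t0 t1].
  have fz : is_flow (fun e => x e + t * (g e - x e)).
    by apply: flow_convex => //; rewrite ltW.
  rewrite -(pmulr_rge0 _ t0); move: (xmin _ fz); rewrite -subr_ge0 => /le_trans; apply.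
  rewrite !total_latencyE -sumrB mulrDr.
  have -> : t * V = \sum_(ed : E * D)
      t * ((val ed.2).+1%:R * coef ed.1 ed.2 a * x ed.1 ^+ val ed.2 * (g ed.1 - x ed.1)).
    rewrite /V mulr_sumr -(pair_bigA _ (fun e (d : D) =>
      t * ((val d).+1%:R * coef e d a * x e ^+ val d * (g e - x e))))/=.
    by apply: eq_bigr => e _; rewrite marginal_costE mulr_suml mulr_sumr.
  rewrite /C !mulr_sumr -big_split/=; apply: ler_sum => -[e d] _ /=.
  have := exprS_sub_le (val d) (flow_itv e fx) (flow_itv e fz).
  move=> /(ler_wpM2l (a_ge0 e d)) /le_trans/= h.
  rewrite -mulrBl mulrC; apply: h; rewrite le_eqVlt; apply/orP; left; apply/eqP.
  ring.
rewrite leNgt; apply/negP => V0.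
have d0 : 0 < C + 1 - V by lra.
(* If V < 0, this t lies in (0, 1] and (C + 1 - V)(V + tC) = V(1 - V) < 0. *)
have := VC (- V / (C + 1 - V)).
rewrite divr_gt0 ?oppr_gt0// ler_pdivrMr// mul1r => /(_ _)/wrap[]; first by lra.
rewrite -(pmulr_rge0 _ d0) (_ : _ * _ = V * (1 - V)); last first.
  by field; rewrite gt_eqF.
by rewrite leNgt nmulr_rlt0// subr_gt0 (lt_trans V0).
Qed.

Lemma equilibrium_variational f g (c : E -> R) : is_flow f -> is_flow g ->
  (forall e e', 0 < f e -> c e <= c e') ->
  0 <= \sum_e c e * (g e - f e).
Proof.
move=> [f0 f1] [g0 g1] cmin.
have [e0 fe0] : exists e, 0 < f e.
  apply: contrapT => nf; have := oner_neq0 R; rewrite -f1 big1 ?eqxx// => e _.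
  by apply/eqP; rewrite eq_le f0 andbT leNgt; apply/negP => fe; apply: nf; exists e.
rewrite [leLHS](_ : _ = \sum_e c e0 * (g e - f e)); last first.
  by rewrite -mulr_sumr sumrB f1 g1 subrr mulr0.
apply: ler_sum => e _.
have [fe|] := ltP 0 (f e).
  by rewrite (_ : c e0 = c e)//; apply/eqP; rewrite eq_le !cmin.
move=> fe; have -> : f e = 0 by apply/eqP; rewrite eq_le fe f0.
by rewrite subr0 ler_wpM2r// cmin.
Qed.

Variable d1 : D.
Hypothesis d1E : val d1 = 1%N.
Hypothesis a1_gt0 : forall e, 0 < coef e d1 a.

(** The degree-1 term alone gives the left-hand side; every other term is nonnegative because powers
    are monotone on nonnegative reals. *)
Lemma latency_strongly_monotone e (y z : R) : 0 <= y -> 0 <= z ->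
  coef e d1 a * (y - z) ^+ 2 <= (latency a e y - latency a e z) * (y - z).
Proof.
move=> y0 z0; rewrite /latency -sumrB mulr_suml (bigD1 d1)//= d1E !expr1.
rewrite -mulrBr -mulrA -expr2 lerDl; apply: sumr_ge0 => d _.
rewrite -mulrBr -mulrA mulr_ge0//.
have [yz|/ltW zy] := leP y z.
  by rewrite mulr_le0 ?subr_le0// lerXn2r.
by rewrite mulr_ge0 ?subr_ge0// lerXn2r.
Qed.

(** The tolls are computed at [x] in both variational inequalities, so they cancel in the sum, and
    strong monotonicity forces each squared difference to vanish. *)
Lemma tolled_equilibrium_opt x f : is_opt_flow a x -> is_flow f ->
  (forall e e', 0 < f e -> latency a e (f e) + Tstar_toll a x e <=
                           latency a e' (f e') + Tstar_toll a x e') ->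
  f = x.
Proof.
move=> xopt ff fmin; have [fx _] := xopt.
have h1 := opt_flow_variational xopt ff.
have h2 := equilibrium_variational ff fx fmin.
have sq0 e : 0 <= coef e d1 a * (f e - x e) ^+ 2 by rewrite mulr_ge0 ?sqr_ge0.
have : \sum_e coef e d1 a * (f e - x e) ^+ 2 == 0.
  rewrite eq_le sumr_ge0// andbT -oppr_ge0.
  apply: le_trans (addr_ge0 h1 h2) _.
  rewrite -sumrN -big_split/=; apply: ler_sum => e _.
  have [f0 _] := ff; have [x0 _] := fx.
  have := latency_strongly_monotone e (f0 e) (x0 e); rewrite /marginal_cost; lra.
rewrite psumr_eq0// => /allP fx0; apply/funext => e.
have := fx0 e (mem_index_enum e); rewrite /= mulf_eq0 gt_eqF//= sqrf_eq0 subr_eq0.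
by move/eqP.
Qed.

End optimal_flows.

(** * Bayes-Nash flows *)

Lemma measure_bigcup_finType d (T : measurableType d) (R : realType)
    (mu : measure T R) (I : finType) (F : I -> set T) :
  (forall i, measurable (F i)) -> trivIset setT F ->
  mu (\bigcup_i F i) = (\sum_i mu (F i))%E.
Proof.
move=> mF tF; rewrite measure_fin_bigcup//; last exact: finite_finset.
rewrite [RHS]fsbig_seq ?index_enum_uniq//; apply: eq_fsbigl.
by apply/seteqP; split=> i //= _; rewrite mem_index_enum.
Qed.

Section bayes_nash.
Variables (R : realType) (E : finType) (D : {fset nat}).
Variables (mu : belief R E D) (M : R).
Hypothesis S_itv : forall a, prior_support mu a ->
  forall e d, 0 <= coef e d a <= M.
Implicit Types (s : info mu) (T : mechanism mu).

Lemma posterior_null s (i : signal s) :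
  posterior i (~` prior_support mu) = 0%E.
Proof.
by case: s i => [pi|] i; [exact: posterior_supportC|exact: prior_supportC_null].
Qed.

Lemma prob_gt0 s (i : signal s) : 0 < signal_prob i.
Proof. by case: s i => [pi|] i; [exact: signal_prob_gt0|exact: ltr01]. Qed.

Lemma mean_coefs_ge0 s (i : signal s) e d :
  0 <= coef e d (mean_coefs (posterior i)).
Proof.
apply: le_trans (alpha_minus_ge0 S_itv e d) _.
exact: (alpha_minus_le_mean S_itv (posterior_null i)).
Qed.

Lemma exp_latency s (i : signal s) e (y c : R) :
  exp_under (posterior i) (fun a => latency a e y + c) =
  latency (mean_coefs (posterior i)) e y + c.
Proof.
have lE (a : coefs R E D) : latency a e y = \sum_(d : D) y ^+ val d * coef e d a.
  by apply: eq_bigr => d _; rewrite mulrC.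
transitivity (exp_under (posterior i)
    (fun a => \sum_(d : D) y ^+ val d * coef e d a + c)).
  by congr exp_under; apply/funext => a; rewrite lE.
rewrite lE; exact: (exp_under_linear S_itv (posterior_null i)
  (fun d : D => y ^+ val d) (fun d => (e, d)) c).
Qed.

Lemma exp_total_latency s (i : signal s) f :
  total_latency_under f (posterior i) =
  total_latency f (mean_coefs (posterior i)).
Proof.
transitivity (exp_under (posterior i)
    (fun a => \sum_(ed : E * D) f ed.1 ^+ (val ed.2).+1 * coef ed.1 ed.2 a + 0)).
  by congr exp_under; apply/funext => a; rewrite addr0 total_latencyE.
rewrite (exp_under_linear S_itv (posterior_null i)
  (fun ed : E * D => f ed.1 ^+ (val ed.2).+1) id 0) addr0 total_latencyE.
by apply: eq_bigr => -[].
Qed.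

(** For a fixed signal the sets of agents on the various edges partition [0, 1]; each has finite
    measure, so [fine] loses nothing. *)
Lemma BN_flow_is_flow s T (f : signal s -> E -> R) (i : signal s) :
  is_BN_flow T f -> is_flow (f i).
Proof.
move=> [sigma [mA fE _]]; split=> [e|]; first by rewrite fE fine_ge0.
have UA : \bigcup_e agents_on sigma i e = `[0, 1]%classic.
  by apply/seteqP; split=> [x [e _ []//]|x x01]; exists (sigma x i).
have finA e : lebesgue_measure (agents_on sigma i e) \is a fin_num.
  rewrite ge0_fin_numE//; apply: (@le_lt_trans _ _ (lebesgue_measure `[0%R, 1%R]%classic)).
    by apply: le_measure; [rewrite inE; exact: mA|rewrite inE|move=> x []].
  by rewrite lebesgue_measure_itv/= lte01 oppr0 adde0 ltry.
apply: EFin_inj; rewrite -sumEFin.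
transitivity (\sum_e lebesgue_measure (agents_on sigma i e))%E.
  by apply: eq_bigr => e _; rewrite fE fineK.
transitivity (lebesgue_measure (`[0%R, 1%R]%classic : set R)); last first.
  by rewrite lebesgue_measure_itv/= lte01 oppr0 adde0.
rewrite -UA; apply: esym; apply: measure_bigcup_finType; first exact: mA.
by move=> e e' _ _ [x [[_ <-] [_ <-]]].
Qed.

(** Positive flow on [e] provides an actual agent there, and that agent may deviate at the single
    signal [i]. *)
Lemma BN_flow_signalwise s T (f : signal s -> E -> R) (i : signal s) (e e' : E) :
  is_BN_flow T f -> 0 < f i e ->
  let m := mean_coefs (posterior i) in
  latency m e (f i e) + T s i e <= latency m e' (f i e') + T s i e'.
Proof.
move=> [sigma [mA fE opt]] fe /=.
have [x [x01 xe]] : agents_on sigma i e !=set0.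
  apply/set0P/eqP => A0; move: fe; rewrite fE A0 measure0 ltxx.
  exact.
have := opt x x01 (fun j => if j == i then e' else sigma x j).
rewrite /agent_cost (bigD1 i)//= [leRHS](bigD1 i)//= eqxx xe.
(* At the other signals the deviation agrees with the original strategy, so those terms cancel; the
   positive probability of [i] is then divided out. *)
under [X in _ <= _ + X]eq_bigr => j /negbTE -> do [].
by rewrite lerD2r ler_pM2l ?prob_gt0// !exp_latency.
Qed.

Variable h1 : 1%N \in D.
Hypothesis alpha1 : forall e, 0 < alpha_minus mu e [` h1]%fset.

Lemma BN_flow_opt s T (f : signal s -> E -> R) (i : signal s) :
  is_Tstar T -> is_BN_flow T f -> is_opt_flow (mean_coefs (posterior i)) (f i).
Proof.
move=> TT bf; have [x [xopt TE]] := TT s i.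
suff -> : f i = x by [].
apply: (@tolled_equilibrium_opt _ _ _ _ _ [` h1]%fset) xopt _ _ => //.
- by move=> e d; exact: mean_coefs_ge0.
- move=> e; apply: lt_le_trans (alpha1 e) _.
  exact: (alpha_minus_le_mean S_itv (posterior_null i)).
- exact: BN_flow_is_flow bf.
- by move=> e e' fe; rewrite -!TE; exact: BN_flow_signalwise.
Qed.

(** For a fixed flow the total latency is linear in the coefficients, and the posterior means
    average to the prior mean. *)
Lemma total_latency_sum_mean (pi : policy mu) f :
  \sum_(i : signal (Some pi)) signal_prob i *
    total_latency f (mean_coefs (posterior i)) =
  total_latency f (mean_coefs mu).
Proof.
under eq_bigr do rewrite total_latencyE mulr_sumr.
rewrite exchange_big total_latencyE /=; apply: eq_bigr => ed _.
rewrite /coef -surjective_pairing -(sum_mean_posterior pi S_itv) mulr_sumr.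
by apply: eq_bigr => i _; rewrite mulrCA; case: ed.
Qed.

Lemma mean_gap_ge e d : mean_coefs mu (e, d) - alpha_minus mu e d <= mean_gap mu.
Proof.
apply: le_trans (ler_norm _) _; rewrite -sqrtr_sqr /mean_gap ler_wsqrtr//.
rewrite (bigD1 e)//= (bigD1 d)//= -addrA lerDl addr_ge0//.
  by apply: sumr_ge0 => d' _; exact: sqr_ge0.
by apply: sumr_ge0 => e' _; apply: sumr_ge0 => d' _; exact: sqr_ge0.
Qed.

Lemma total_latency_mean_gap s (i : signal s) f : is_flow f ->
  total_latency f (mean_coefs mu) - total_latency f (mean_coefs (posterior i)) <=
  #|` D|%:R * mean_gap mu.
Proof.
move=> ff; have [f0 f1] := ff; rewrite !total_latencyE -sumrB.
have -> : #|` D|%:R * mean_gap mu = \sum_(ed : E * D) f ed.1 * mean_gap mu.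
  rewrite -(pair_bigA _ (fun e (d : D) => f e * mean_gap mu))/= exchange_big/=.
  under eq_bigr do rewrite -mulr_suml f1 mul1r.
  by rewrite sumr_const cardfE mulr_natl.
apply: ler_sum => -[e d] _ /=; rewrite -mulrBr.
have gap0 : 0 <= mean_gap mu by exact: sqrtr_ge0.
apply: (@le_trans _ _ (f e ^+ (val d).+1 * mean_gap mu)).
  rewrite ler_wpM2l ?exprn_ge0//; apply: le_trans (mean_gap_ge e d).
  by rewrite lerD2l lerN2; exact: (alpha_minus_le_mean S_itv (posterior_null i)).
rewrite ler_wpM2r// exprS ler_piMr// exprn_ile1//.
by have /andP[] := flow_itv e ff.
Qed.

(** The second summand of [Xi] is nonnegative: the degree-0 term of [rho_plus] at any edge already
    dominates the degree-0 [rho_minus]. *)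
Lemma Xi_ge (h0 : 0%N \in D) : (0 < #|E|)%N -> #|` D|%:R <= Xi mu h0 h1.
Proof.
move=> /card_gt0P[e0 _]; rewrite /Xi lerDl mulr_ge0//; last first.
  by rewrite addr_ge0// sumr_ge0// => d _; exact: exprn_ge0.
rewrite divr_ge0//; last first.
  rewrite mulr_ge0//; apply: lb_le_inf; first by exists (alpha_minus mu e0 [` h1]%fset), e0.
  by move=> _ [e _ <-]; exact: (alpha_minus_ge0 S_itv).
rewrite subr_ge0.
pose F e := \sum_(d : D) (val d).+1%:R * alpha_plus mu e d.
have ap0 e d : 0 <= alpha_plus mu e d.
  exact: le_trans (alpha_minus_ge0 S_itv e d) (alpha_minus_le_plus S_itv e d).
apply: (@le_trans _ _ (F e0)); last first.
  apply: ub_le_sup; last by exists e0.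
  exists (\sum_(d : D) (val d).+1%:R * M) => _ [e _ <-].
  by apply: ler_sum => d _; rewrite ler_wpM2l//; exact: (alpha_plus_le S_itv).
apply: (@le_trans _ _ (alpha_minus mu e0 [` h0]%fset)).
  apply: ge_inf; last by exists e0.
  by exists 0 => _ [e _ <-]; exact: (alpha_minus_ge0 S_itv).
apply: le_trans (alpha_minus_le_plus S_itv _ _) _.
rewrite /F (bigD1 [` h0]%fset)//= mul1r lerDl; apply: sumr_ge0 => d _.
by rewrite mulr_ge0.
Qed.

End bayes_nash.

(** * The two bounds on the benefit *)

Theorem theorem2 (R : realType) (D : {fset nat}) (h0 : 0%N \in D) (h1 : 1%N \in D)
    (E : finType) (hE : (0 < #|E|)%N) (mu0 : belief R E D)
    (hbounded : bounded_coefs (prior_support mu0))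
    (hnonneg : forall a, prior_support mu0 a -> forall e d, 0 <= coef e d a)
    (halpha0 : forall e, 0 < alpha_minus mu0 e [` h0]%fset)
    (halpha1 : forall e, 0 < alpha_minus mu0 e [` h1]%fset)
    (pi : policy mu0) (T : mechanism mu0) (hT : is_Tstar T)
    (b : R) (hb : is_benefit pi T b) :
  0 <= b <= Xi mu0 h0 h1 * mean_gap mu0.
Proof.
have [M SM] := hbounded.
have S_itv a : prior_support mu0 a -> forall e d, 0 <= coef e d a <= M.
  by move=> Sa e d; rewrite hnonneg//= (le_trans (ler_norm _))// SM.
have [f0 [f [bf0 bf ->]]] := hb.
have f0opt : is_opt_flow (mean_coefs mu0) (f0 tt) :=
  BN_flow_opt S_itv halpha1 (tt : signal (None : info mu0)) hT bf0.
have fopt (i : signal (Some pi)) := BN_flow_opt S_itv halpha1 i hT bf.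
have -> : expected_latency f0 = total_latency (f0 tt) (mean_coefs mu0).
  rewrite /expected_latency (bigD1 tt)//= big1 => [|[]//].
  by rewrite addr0 mul1r (exp_total_latency S_itv (tt : signal (None : info mu0))).
have -> : expected_latency f = \sum_(i : signal (Some pi)) signal_prob i *
    total_latency (f i) (mean_coefs (posterior i)).
  by apply: eq_bigr => i _; rewrite (exp_total_latency S_itv).
apply/andP; split.
  (* The uninformed flow is a feasible competitor to the optimal flow [f i] under each posterior
     mean. *)
  rewrite subr_ge0 -(total_latency_sum_mean S_itv pi); apply: ler_sum => i _.
  by rewrite ler_wpM2l ?(ltW (prob_gt0 i))//; apply: (fopt i).2; exact: f0opt.1.
apply: (@le_trans _ _ (#|` D|%:R * mean_gap mu0)); last first.
  by rewrite ler_wpM2r ?sqrtr_ge0//; exact: (Xi_ge S_itv).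
(* Since the signal probabilities sum to 1, constants become averages over signals and the bound
   reduces to a single signal. There [f i] competes with [f0 tt] at the prior mean. *)
have mulp (c : R) : c = \sum_(i : signal (Some pi)) signal_prob i * c.
  by rewrite -mulr_suml sum_signal_prob mul1r.
rewrite [leRHS]mulp [X in X - _]mulp -sumrB; apply: ler_sum => i _.
rewrite -mulrBr ler_wpM2l ?(ltW (prob_gt0 i))//.
apply: le_trans (total_latency_mean_gap S_itv i (fopt i).1).
by rewrite lerD2r; apply: f0opt.2; exact: (fopt i).1.
Qed.
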